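(* One has $P=Q$ (equality of the two sets of sequences defined in the context). Moreover, if $\alpha=(\alpha_1,\dots,\alpha_r)$ and $\beta=(\beta_1,\dots,\beta_s)$ are $R$-partitioned sequences ($rs\ne0$) and $e_1,\dots,e_{q_1},f_1,\dots,f_{q_2}\in\mathbb{N}$ ($q_1q_2\neq 0$) are such that $$C_{(\alpha,\beta)}^n\frac{(\alpha_1)_n\cdots(\alpha_r)_n}{n!(\beta_1)_n\cdots(\beta_s)_n}=\frac{(e_1 n)!\cdots (e_{q_1} n)!}{(f_1 n)!\cdots (f_{q_2} n)!}\quad\text{for all } n\geq 0,$$ then $$C_{(\alpha,\beta)}=\frac{e_1^{e_1}\cdots e_{q_1}^{e_{q_1}}}{f_1^{f_1}\cdots f_{q_2}^{f_{q_2}}}\quad\text{and}\quad r-s-1=|\mathbf{e}|-|\mathbf{f}|.$$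
   Context: $\mathbb{N}=\{0,1,2,\dots\}$, $0^0=1$; $|\mathbf{e}|=\sum_{i=1}^{q_1}e_i$, $|\mathbf{f}|=\sum_{j=1}^{q_2}f_j$. Pochhammer symbol: $(x)_0=1$ and $(x)_n=x(x+1)\cdots(x+n-1)$ for $n\ge1$. $\varphi$ is Euler's totient function ($\varphi(1)=1$). For an integer $N\geq 1$ let $R_N=\{w/N : 1\leq w\leq N,\ (w,N)=1\}$. A multiset (or finite sequence) $\{\alpha_1,\dots,\alpha_r\}$ of real numbers is called $R$-partitioned according to the multiset $\{N_1,\dots,N_k\}$ of positive integers if there is a partition $E_1,\dots,E_k$ of $\{1,\dots,r\}$ such that for every $j\in\{1,\dots,k\}$, $\mathrm{Card}(E_j)=\varphi(N_j)$ and $\{\alpha_i : i\in E_j\}=R_{N_j}$. It is called $R$-partitioned if such positive integers $N_1,\dots,N_k$ exist. For $N\ge1$ let $C_N=N^{\varphi(N)}\prod_{p\mid N}p^{\varphi(N)/(p-1)}$ (product over primes $p$ dividing $N$). If $\alpha$ is $R$-partitioned according to $(N_1,\dots,N_k)$, let $C_\alpha=C_{N_1}\cdots C_{N_k}$. If $\alpha$ and $\beta$ are $R$-partitioned, let $C_{(\alpha,\beta)}=C_\alpha/C_\beta$. $Q$ is the set of all sequences $n\mapsto\frac{(e_1 n)!\cdots (e_{q_1} n)!}{(f_1 n)!\cdots (f_{q_2} n)!}$ $(n\ge0)$ with $q_1,q_2\in\mathbb{N}$, $q_1q_2\neq0$, and $e_1,\dots,e_{q_1},f_1,\dots,f_{q_2}\in\mathbb{N}$.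 $P$ is the set of all sequences $n\mapsto C_{(\alpha,\beta)}^n\frac{(\alpha_1)_n\cdots(\alpha_r)_n}{n!(\beta_1)_n\cdots(\beta_s)_n}$ $(n\ge0)$ with $r,s\in\mathbb{N}$, $rs\neq0$, and $(\alpha_1,\dots,\alpha_r)$, $(\beta_1,\dots,\beta_s)$ two $R$-partitioned sequences. *)

(* Defs.v *)
From mathcomp Require Import all_boot all_order all_algebra.
From mathcomp Require Import boolp classical_sets reals.

Set Implicit Arguments.
Unset Strict Implicit.
Unset Printing Implicit Defensive.

Import Order.TTheory GRing.Theory Num.Theory.
Local Open Scope ring_scope.

Definition pochhammer (R : realType) (x : R) (n : nat) : R :=
  \prod_(i < n) (x + i%:R).

Definition Rset (R : realType) (N : nat) : set R :=
  [set x | exists w : nat,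
     [/\ (1 <= w <= N)%N, coprime w N & x = w%:R / N%:R]]%classic.
Arguments Rset : clear implicits.

(* The indices 1, ..., r of a sequence of length r become 0, ..., r - 1. *)
Definition Rpartitioned_by (R : realType) (a : seq R) (Ns : seq nat) : Prop :=
  (forall N, N \in Ns -> (0 < N)%N) /\
  exists E : 'I_(size Ns) -> {set 'I_(size a)},
    [/\ forall j1 j2, j1 != j2 -> [disjoint E j1 & E j2],
        \bigcup_j E j = [set: 'I_(size a)],
        forall j, #|E j| = totient (nth 0%N Ns j) &
        forall j, [set x | exists2 i, i \in E j & x = a`_i]%classic
                  = Rset R (nth 0%N Ns j)].

Definition Rpartitioned (R : realType) (a : seq R) : Prop :=
  exists Ns, Rpartitioned_by a Ns.

(* The division by p - 1 is exact, since p - 1 divides totient N whenever the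
   prime p divides N. *)
Definition Cnat (N : nat) : nat :=
  (N ^ totient N * \prod_(p <- primes N) p ^ (totient N %/ p.-1))%N.

(* Independent of the choice of Ns, see CseqE; junk value 1 if a is not
   R-partitioned. *)
Definition Cseq (R : realType) (a : seq R) : nat :=
  (\prod_(N <- xget [::] [set Ns | Rpartitioned_by a Ns]%classic) Cnat N)%N.

Definition Cpair (R : realType) (a b : seq R) : R :=
  (Cseq a)%:R / (Cseq b)%:R.

Definition factorial_ratio (R : realType) (e f : seq nat) (n : nat) : R :=
  (\prod_(x <- e) (x * n)`!)%N%:R / (\prod_(y <- f) (y * n)`!)%N%:R.

Definition hypergeometric_coef (R : realType) (a b : seq R) (n : nat) : R :=
  Cpair a b ^+ n *
    ((\prod_(x <- a) pochhammer x n)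
     / (n`!%:R * \prod_(y <- b) pochhammer y n)).

Definition Qset (R : realType) : set (nat -> R) :=
  [set u | exists e f : seq nat,
     [/\ (0 < size e)%N, (0 < size f)%N & u = factorial_ratio R e f]]%classic.
Arguments Qset : clear implicits.

Definition Pset (R : realType) : set (nat -> R) :=
  [set u | exists a b : seq R,
     [/\ (0 < size a)%N, (0 < size b)%N, Rpartitioned a, Rpartitioned b
       & u = hypergeometric_coef a b]]%classic.
Arguments Pset : clear implicits.

Section CseqWellDefined.
Variable R : realType.

Let Rlist (N : nat) : seq R :=
  [seq w%:R / N%:R | w <- [seq w <- iota 1 N | coprime w N]].

Let mem_Rlist N (x : R) : reflect (Rset R N x) (x \in Rlist N).
Proof.
apply: (iffP mapP) => [[w]|[w [w1N cw ->]]].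
  by rewrite mem_filter mem_iota add1n ltnS => /andP[? ?] ->; exists w.
by exists w => //; rewrite mem_filter mem_iota add1n ltnS cw.
Qed.

Let size_Rlist N : (0 < N)%N -> size (Rlist N) = totient N.
Proof.
move=> N0; rewrite size_map size_filter totient_count_coprime.
rewrite -sum1_count big_mkcond /=.
have -> : iota 1 N = index_iota 1 N.+1 by rewrite /index_iota subn1.
rewrite big_nat_recr //= [in RHS]big_ltn //= addnC; congr (_ + _)%N.
  by rewrite /coprime gcdnn gcdn0; case: eqP.
by apply: eq_bigr => i _; rewrite coprime_sym; case: coprime.
Qed.

Let uniq_Rlist N : (0 < N)%N -> uniq (Rlist N).
Proof.
move=> N0; rewrite map_inj_uniq ?filter_uniq ?iota_uniq // => x y.
have N0' : (N%:R : R) != 0 by rewrite pnatr_eq0 -lt0n.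
by move/(mulIf (invr_neq0 N0')) => /eqP; rewrite eqr_nat => /eqP.
Qed.

Let invr_Rlist N M : (0 < N)%N -> (0 < M)%N ->
  ((M%:R^-1 : R) \in Rlist N) = (N == M).
Proof.
move=> N0 M0; apply/mem_Rlist/eqP => [[w [/andP[w1 wN] cw]]|->]; last first.
  by exists 1%N; rewrite M0 coprime1n mul1r.
have N0' : (N%:R : R) != 0 by rewrite pnatr_eq0 -lt0n.
have M0' : (M%:R : R) != 0 by rewrite pnatr_eq0 -lt0n.
move=> /(congr1 (fun z => z * M%:R * N%:R)).
rewrite mulVf // mul1r mulrAC divfK // -natrM => /eqP.
rewrite eqr_nat => /eqP NE.
move: cw; rewrite NE /coprime gcdnMr => /eqP w1'.
by rewrite w1' mul1n.
Qed.

Let count_Rpartition (a : seq R) Ns M : Rpartitioned_by a Ns -> (0 < M)%N ->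
  count_mem M Ns = (\sum_(i < size a) (a`_i == M%:R^-1)%R)%N.
Proof.
move=> [Ns0 [E [disjE covE cardN imE]]] M0.
have -> : (\sum_(i < size a) (a`_i == M%:R^-1)%R =
    \sum_(i in \bigcup_j E j) (a`_i == M%:R^-1)%R)%N.
  by rewrite covE; apply: eq_bigl => i; rewrite finset.in_setT.
rewrite partition_disjoint_bigcup //=.
rewrite -sum1_count big_mkcond /= (big_nth 0%N) big_mkord; apply: eq_bigr => j _.
set N := nth 0%N Ns j.
have N0 : (0 < N)%N by apply: Ns0; rewrite mem_nth.
set s := [seq a`_(nat_of_ord i) | i <- enum (E j)].
have sE : s =i Rlist N.
  move=> x; apply/idP/idP.
    case/mapP => i; rewrite mem_enum => iE ->; apply/mem_Rlist.
    by rewrite -imE; exists i.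
  move=> /mem_Rlist; rewrite -imE => -[i /= iE ->].
  by apply/mapP; exists i => //; rewrite mem_enum.
have ss : size s = size (Rlist N) by rewrite size_map -cardE cardN size_Rlist.
have us : uniq s.
  rewrite (@leq_size_uniq _ (Rlist N)) ?uniq_Rlist ?ss // => x.
  by rewrite sE.
transitivity (count_mem (M%:R^-1) s).
  by rewrite count_uniq_mem // sE invr_Rlist //; case: eqP.
rewrite count_map -sum1_count big_mkcond /= big_enum /=.
by apply: eq_bigr => i _; case: eqP.
Qed.

Lemma Rpartitioned_by_perm (a : seq R) Ns Ns' :
  Rpartitioned_by a Ns -> Rpartitioned_by a Ns' -> perm_eq Ns Ns'.
Proof.
move=> H H'; apply/allP => M; rewrite mem_cat => MN /=; apply/eqP.
have M0 : (0 < M)%N by case/orP: MN; [apply: H.1|apply: H'.1].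
by rewrite (count_Rpartition H) // (count_Rpartition H').
Qed.

Lemma CseqE (a : seq R) Ns :
  Rpartitioned_by a Ns -> Cseq a = (\prod_(N <- Ns) Cnat N)%N.
Proof.
move=> H; apply: perm_big; apply: (Rpartitioned_by_perm _ H).
exact: (@xgetI _ [::] [set Ns | Rpartitioned_by a Ns]%classic _ H).
Qed.

End CseqWellDefined.

(* Main.v *)
Require Import Defs.
From mathcomp Require Import all_boot all_order all_algebra.
From mathcomp Require Import boolp classical_sets reals.
From mathcomp Require Import ring zify.

Set Implicit Arguments.
Unset Strict Implicit.
Unset Printing Implicit Defensive.

Import Order.TTheory GRing.Theory Num.Theory.
Local Open Scope ring_scope.

(** Everything rests on the multiplication formula
      (m n)! = (m^m)^n * (1/m)_n (2/m)_n ... (m/m)_n        (m > 0).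
    Writing the fractions w/m in lowest terms sorts them into the sets R_d for
    d dividing m ([big_coprimes_divisors]), and the constants match because
    the product of C_d over the divisors d of m is m^m
    ([prod_Cnat_divisors]).  So, with
      B_N(n) = C_N^n * prod_(x in R_N) (x)_n                 ([Rblock]),
    (m n)! is the product of the B_d(n) over d | m
    ([prod_Rblock_divisors]).  The numerators and denominators of elements of
    P are products of blocks B_N, up to n! = B_1(n).

    Hence Q is contained in P: replace every factorial by the blocks of its
    divisors.  Conversely, solving (N n)! = prod_(d | N) B_d(n) for B_N(n)
    shows by induction on N that B_N is a quotient of products of factorials
    (this is Moebius inversion without the Moebius function), so P is
    contained in Q.

    For the remaining claims, divide the equality of the two sequences at
    n + 1 by the equality at n.  Both Pochhammer symbols and factorials (m n)!
    get multiplied by products of linear polynomials evaluated at n, so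
      C * prod (X + a_i) * prod_y prod_(k = 1..y) (y X + k)
        = (X + 1) * prod (X + b_j) * prod_x prod_(k = 1..x) (x X + k)
    holds at every natural number n, hence as polynomials
    ([hypergeometric_factorial_poly]).  Comparing leading coefficients gives
    the formula for C, and comparing degrees gives r - s - 1 = |e| - |f|. *)

(** * Fractions in lowest terms and Gauss's totient sum *)

(** The numerators of the elements of R_N. *)
Definition coprimes (N : nat) : seq nat := [seq w <- iota 1 N | coprime w N].

Lemma mem_coprimes N w :
  (w \in coprimes N) = (0 < w <= N)%N && coprime w N.
Proof. by rewrite mem_filter mem_iota add1n ltnS andbC. Qed.

Lemma coprimes_uniq N : uniq (coprimes N).
Proof. by rewrite filter_uniq ?iota_uniq. Qed.

Lemma size_coprimes N : (0 < N)%N -> size (coprimes N) = totient N.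
Proof.
move=> N_gt0; rewrite size_filter totient_count_coprime -sum1_count big_mkcond /=.
have -> : iota 1 N = index_iota 1 N.+1 by rewrite /index_iota subn1.
rewrite big_nat_recr //= [in RHS]big_ltn //= addnC; congr (_ + _)%N.
  by rewrite /coprime gcdnn gcdn0; case: eqP.
by apply: eq_bigr => i _; rewrite coprime_sym; case: coprime.
Qed.

(** Reduce each fraction w/m to lowest terms v/d: here d = m / gcd(w, m) runs
    over the divisors of m, and w = v (m/d) with v a numerator of R_d.  Stated
    for an arbitrary commutative operation, so that it counts (giving Gauss's
    totient sum) as well as it multiplies Pochhammer symbols. *)
Lemma big_coprimes_divisors (T : Type) (idx : T) (op : Monoid.com_law idx)
    (m : nat) (F : nat -> T) : (0 < m)%N ->
  \big[op/idx]_(d <- divisors m) \big[op/idx]_(v <- coprimes d) F (v * (m %/ d))%N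
  = \big[op/idx]_(w <- iota 1 m) F w.
Proof.
move=> m_gt0.
have reduced d : d \in divisors m ->
    perm_eq [seq (v * (m %/ d))%N | v <- coprimes d]
            [seq w <- iota 1 m | (m %/ gcdn w m == d)%N].
  rewrite -dvdn_divisors // => d_dvd.
  have d_gt0 := dvdn_gt0 m_gt0 d_dvd.
  have [q defm] := dvdnP d_dvd.
  have q_gt0 : (0 < q)%N by move: m_gt0; rewrite defm muln_gt0 => /andP[].
  have -> : (m %/ d = q)%N by rewrite defm mulnK.
  apply: uniq_perm; first 1 last.
  - by rewrite filter_uniq ?iota_uniq.
  - move=> w; apply/mapP/idP => [[v] | ].
      rewrite mem_coprimes => /andP[/andP[v_gt0 v_le] cop] ->.
      rewrite mem_filter mem_iota add1n ltnS muln_gt0 v_gt0 q_gt0 /=.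
      rewrite defm (mulnC v) leq_mul2l v_le orbT andbT -muln_gcdr.
      by rewrite (eqP cop) muln1 mulKn.
    rewrite mem_filter mem_iota add1n ltnS => /and3P[/eqP wd w_gt0 w_le].
    have g_gt0 : (0 < gcdn w m)%N by rewrite gcdn_gt0 w_gt0.
    have gq : gcdn w m = q.
      apply/eqP; rewrite -(eqn_pmul2l d_gt0) -{1}wd divnK ?dvdn_gcdr //.
      by rewrite defm mulnC.
    have [v defw] : exists v, w = (v * q)%N.
      by apply/dvdnP; rewrite -gq dvdn_gcdl.
    exists v => //; rewrite mem_coprimes.
    move: w_gt0 w_le gq; rewrite defw defm (mulnC q) leq_pmul2r // muln_gt0.
    move=> /andP[-> _] -> /eqP; rewrite -muln_gcdl -{2}[q]mul1n.
    by rewrite eqn_pmul2r.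
  - rewrite map_inj_uniq ?coprimes_uniq // => x y /eqP.
    by rewrite eqn_pmul2r // => /eqP.
rewrite (eq_big_seq (fun d =>
    \big[op/idx]_(w <- iota 1 m | (m %/ gcdn w m == d)%N) F w)); last first.
  by move=> d d_div; rewrite -[RHS]big_filter -(perm_big _ (reduced d d_div)) big_map.
rewrite (exchange_big_dep xpredT) //=; apply: eq_big_seq => w.
rewrite mem_iota add1n ltnS => /andP[w_gt0 w_le].
have div_w : (m %/ gcdn w m)%N \in divisors m.
  by rewrite -dvdn_divisors // -[X in (_ %| X)%N](divnK (dvdn_gcdr w m)) dvdn_mulr.
rewrite -big_filter; set s := filter _ _.
suff -> : s = [:: m %/ gcdn w m]%N by rewrite big_seq1.
rewrite /s (eq_filter (a2 := pred1 (m %/ gcdn w m)%N)).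
  by rewrite filter_pred1_uniq ?divisors_uniq.
by move=> d; rewrite /= eq_sym.
Qed.

Lemma sum_totient_divisors m :
  (0 < m)%N -> (\sum_(d <- divisors m) totient d = m)%N.
Proof.
move=> m_gt0.
have := big_coprimes_divisors addn (fun=> 1%N) m_gt0.
rewrite sum1_size size_iota => {2}<-; apply: eq_big_seq => d.
rewrite -dvdn_divisors // => /(dvdn_gt0 m_gt0) d_gt0.
by rewrite sum1_size size_coprimes.
Qed.

(** * The product of the constants C_d over the divisors of m *)

Lemma logn_prod (I : eqType) p (s : seq I) (F : I -> nat) :
  {in s, forall i, 0 < F i}%N ->
  logn p (\prod_(i <- s) F i) = (\sum_(i <- s) logn p (F i))%N.
Proof.
elim: s => [|i s IHs] F_gt0; first by rewrite !big_nil logn1.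
have F_gt0s : {in s, forall j, 0 < F j}%N.
  by move=> j js; rewrite F_gt0 // inE js orbT.
rewrite !big_cons lognM ?IHs ?F_gt0 ?mem_head // big_seq.
exact: prodn_cond_gt0.
Qed.

Lemma prime_pred_dvdn_totient p N :
  prime p -> (0 < N)%N -> (p %| N)%N -> (p.-1 %| totient N)%N.
Proof.
move=> p_pr N_gt0 pN; rewrite totientE //.
rewrite (big_rem p) ?mem_primes ?p_pr ?N_gt0 //=.
by rewrite -mulnA dvdn_mulr.
Qed.

Lemma primes_pow_gt0 N : {in primes N, forall q, 0 < q ^ (totient N %/ q.-1)}%N.
Proof.
by move=> q; rewrite mem_primes => /andP[/prime_gt0 q_gt0 _]; rewrite expn_gt0 q_gt0.
Qed.

Lemma Cnat_gt0 N : (0 < N)%N -> (0 < Cnat N)%N.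
Proof.
move=> N_gt0; rewrite muln_gt0 expn_gt0 N_gt0 /= big_seq.
exact/prodn_cond_gt0/primes_pow_gt0.
Qed.

(** Multiplying by p - 1 keeps the exponent phi(N) / (p - 1) of p in the
    product over primes inside the natural numbers. *)
Lemma logn_Cnat p N : prime p -> (0 < N)%N ->
  (p.-1 * logn p (Cnat N)
    = if p %| N then totient N * (p.-1 * logn p N).+1 else 0)%N.
Proof.
move=> p_pr N_gt0; have Cprod_gt0 : (0 < \prod_(q <- primes N) q ^ (totient N %/ q.-1))%N.
  by rewrite big_seq; exact/prodn_cond_gt0/primes_pow_gt0.
rewrite lognM ?expn_gt0 ?N_gt0 // lognX logn_prod; last exact: primes_pow_gt0.
rewrite (eq_big_seq (fun q => if q == p then totient N %/ p.-1 else 0)%N); last first.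
  move=> q; rewrite mem_primes => /andP[q_pr _]; rewrite lognX logn_prime //.
  by rewrite eq_sym; case: eqP => [->|]; rewrite ?muln1 ?muln0.
rewrite -big_mkcond /=; case: ifPn => pN.
  have p_in : p \in primes N by rewrite mem_primes p_pr N_gt0.
  rewrite -big_filter filter_pred1_uniq ?primes_uniq // big_seq1 mulnDr.
  by rewrite (mulnC _ (_ %/ _)%N) divnK ?prime_pred_dvdn_totient // mulnS addnC mulnCA.
rewrite -big_filter (@eq_in_filter _ _ pred0); last first.
  by move=> q /=; case: eqP => // ->; rewrite mem_primes (negPf pN) !andbF.
rewrite filter_pred0 big_nil addn0 logn_coprime ?muln0 //.
by rewrite prime_coprime.
Qed.

(** Strip one factor p from m = k p.  The divisors of m that do not divide k
    are those of full p-adic valuation v = v_p(m), and by Gauss's sum their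
    totients add up to m - k = (p - 1) k.  Since v_p(C_d) =
    phi(d) (v + 1/(p - 1)) for each of them, they contribute
    (p - 1) k v + k, which is exactly m v - k (v - 1). *)
Lemma sum_logn_Cnat p m : prime p -> (0 < m)%N ->
  (\sum_(d <- divisors m) logn p (Cnat d) = m * logn p m)%N.
Proof.
move=> p_pr; have p1_gt0 : (0 < p.-1)%N by rewrite -ltnS (ltn_predK (prime_gt1 p_pr)) prime_gt1.
elim/ltn_ind: m => m IHm m_gt0; have [pm|pNm] := boolP (p %| m)%N; last first.
  rewrite (logn_coprime (m := m)) ?prime_coprime // muln0 big_seq big1 // => d.
  rewrite -dvdn_divisors // => d_dvd; apply/eqP; rewrite -(eqn_pmul2l p1_gt0).
  rewrite logn_Cnat ?(dvdn_gt0 m_gt0) // muln0 ifN //.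
  by apply: contra pNm => /dvdn_trans->.
have [k defm] := dvdnP pm.
have k_gt0 : (0 < k)%N by move: m_gt0; rewrite defm muln_gt0 => /andP[].
have k_lt : (k < m)%N by rewrite defm ltn_Pmulr ?prime_gt1.
have k_dvd : (k %| m)%N by rewrite defm dvdn_mulr.
have div_k : perm_eq [seq d <- divisors m | (d %| k)%N] (divisors k).
  apply: uniq_perm; rewrite ?filter_uniq ?divisors_uniq // => d.
  rewrite mem_filter -!dvdn_divisors //; case: (boolP (d %| k)%N) => //= dk.
  by rewrite (dvdn_trans dk).
have split_k F : (\sum_(d <- divisors m) F d =
    \sum_(d <- divisors k) F d + \sum_(d <- divisors m | ~~ (d %| k)) F d)%N.
  by rewrite (bigID (fun d => d %| k)%N) /= -(big_filter _ (fun d => d %| k)%N) (perm_big _ div_k).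
have log_m : (logn p m = (logn p k).+1)%N.
  by rewrite defm lognM ?(prime_gt0 p_pr) // (logn_prime p p_pr) eqxx addn1.
(* A divisor of k p that does not divide k uses up every factor p of k p. *)
have new d : (d %| m)%N -> ~~ (d %| k)%N -> logn p d = logn p m /\ (p %| d)%N.
  move=> d_dvd dNk; have d_gt0 := dvdn_gt0 m_gt0 d_dvd.
  suff e : logn p d = logn p m.
    by split=> //; rewrite -[p]expn1 pfactor_dvdn // e log_m.
  apply/eqP; rewrite eqn_leq dvdn_leq_log //= leqNgt log_m ltnS; apply: contra dNk => le.
  have [q defd] := dvdnP d_dvd.
  have q_gt0 : (0 < q)%N by move: m_gt0; rewrite defd muln_gt0 => /andP[].
  have pq : (p %| q)%N.
    rewrite -[p]expn1 pfactor_dvdn //.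
    by move: log_m; rewrite defd lognM // => e; rewrite -(ltn_add2r (logn p d)) add0n e ltnS.
  have [q' defq] := dvdnP pq.
  apply/dvdnP; exists q'; apply/eqP; rewrite -(eqn_pmul2r (prime_gt0 p_pr)).
  by rewrite -defm defd defq mulnAC.
have sum_new : (\sum_(d <- divisors m | ~~ (d %| k)) totient d = p.-1 * k)%N.
  apply/eqP; rewrite -(eqn_add2l k) -{1}(sum_totient_divisors k_gt0) // -split_k.
  by rewrite sum_totient_divisors // -mulSn prednK ?prime_gt0 // defm mulnC.
apply/eqP; rewrite -(eqn_pmul2l p1_gt0) split_k IHm // mulnDr [X in (_ + X)%N]big_distrr /=.
rewrite big_seq_cond.
rewrite (eq_bigr (fun d => totient d * (p.-1 * logn p m).+1)%N); last first.
  move=> d /andP[]; rewrite -dvdn_divisors // => d_dvd /(new _ d_dvd)[e pd].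
  by rewrite logn_Cnat ?(dvdn_gt0 m_gt0) // pd e.
rewrite -big_seq_cond -big_distrl /= sum_new log_m defm -(prednK (prime_gt0 p_pr)) /=.
apply/eqP; ring.
Qed.

Lemma prod_Cnat_divisors m :
  (0 < m)%N -> (\prod_(d <- divisors m) Cnat d = m ^ m)%N.
Proof.
move=> m_gt0; have C_gt0 : {in divisors m, forall d, 0 < Cnat d}%N.
  by move=> d; rewrite -dvdn_divisors // => /(dvdn_gt0 m_gt0)/Cnat_gt0.
apply: eqn_from_log => [||p]; rewrite ?expn_gt0 ?m_gt0 //.
  by rewrite big_seq; apply: prodn_cond_gt0.
have [p_pr|pNpr] := boolP (prime p); last first.
  have log0 n : logn p n = 0%N by rewrite lognE (negPf pNpr).
  by rewrite !log0.
by rewrite logn_prod // sum_logn_Cnat // lognX.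
Qed.

(** * R-partitioned sequences as concatenations *)

Definition Rlist (R : realType) (N : nat) : seq R :=
  [seq w%:R / N%:R | w <- coprimes N].

Lemma mem_Rlist (R : realType) N (x : R) : reflect (Rset R N x) (x \in Rlist R N).
Proof.
apply: (iffP mapP) => [[w]|[w [w1N cw ->]]].
  by rewrite mem_coprimes => /andP[? ?] ->; exists w.
by exists w => //; rewrite mem_coprimes w1N.
Qed.

Lemma Rlist_uniq (R : realType) N : (0 < N)%N -> uniq (Rlist R N).
Proof.
move=> N_gt0; rewrite map_inj_uniq ?coprimes_uniq // => x y.
have N_neq0 : (N%:R : R) != 0 by rewrite pnatr_eq0 -lt0n.
by move/(mulIf (invr_neq0 N_neq0)) => /eqP; rewrite eqr_nat => /eqP.
Qed.

Lemma size_Rlist (R : realType) N : (0 < N)%N -> size (Rlist R N) = totient N.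
Proof. by move=> N_gt0; rewrite size_map size_coprimes. Qed.

Lemma Rlist_gt0 (R : realType) N (x : R) : x \in Rlist R N -> 0 < x.
Proof.
case/mapP=> w; rewrite mem_coprimes => /andP[/andP[w_gt0 w_le] _] ->.
by rewrite divr_gt0 ?ltr0n // (leq_trans w_gt0).
Qed.

(** The sequence a_i, i in E_j, has the same elements as R_(N_j), and the
    equality of cardinals excludes repetitions.  So an R-partition of a amounts
    to a listing of a, up to order, as a concatenation of the R_N; this is the
    form in which products over a are computed. *)
Lemma Rpartitioned_perm (R : realType) (a : seq R) Ns :
  Rpartitioned_by a Ns -> perm_eq a (flatten [seq Rlist R N | N <- Ns]).
Proof.
move=> [Ns_gt0 [E [disjE covE cardN imE]]]; apply/allP => x _; apply/eqP.
pose s j := [seq a`_(nat_of_ord i) | i <- enum (E j)].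
have s_perm j : perm_eq (s j) (Rlist R (nth 0%N Ns j)).
  have N_gt0 : (0 < nth 0%N Ns j)%N by rewrite Ns_gt0 ?mem_nth.
  have memE : s j =i Rlist R (nth 0%N Ns j).
    move=> y; apply/mapP/mem_Rlist => [[i]|]; rewrite -imE.
      by rewrite mem_enum => iE ->; exists i.
    by move=> [i iE ->]; exists i; rewrite ?mem_enum.
  have sz : size (s j) = size (Rlist R (nth 0%N Ns j)).
    by rewrite size_map -cardE cardN size_Rlist.
  apply: uniq_perm => //; last exact: Rlist_uniq.
  by rewrite (leq_size_uniq (Rlist_uniq R N_gt0)) ?sz // => y; rewrite memE.
rewrite count_flatten -map_comp sumnE big_map (big_nth 0%N) big_mkord.
rewrite -sum1_count big_mkcond (big_nth 0%R) big_mkord.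
(* The number of occurrences of x in a is computed block by block. *)
transitivity (\sum_(i in \bigcup_j E j) (if (a`_i == x)%R then 1 else 0))%N.
  by rewrite covE; apply: eq_bigl => i; rewrite finset.in_setT.
rewrite partition_disjoint_bigcup //; apply: eq_bigr => j _.
rewrite /= -(permP (s_perm j)) count_map -sum1_count [RHS]big_mkcond /= big_enum /=.
by apply: eq_bigr => i _.
Qed.

(** E_j consists of the positions of the j-th block of the concatenation; it
    has the right cardinal because a block lists R_N without repetition. *)
Lemma Rpartitioned_flatten (R : realType) Ns : {in Ns, forall N, 0 < N}%N ->
  Rpartitioned_by (flatten [seq Rlist R N | N <- Ns]) Ns.
Proof.
move=> Ns_gt0; split=> //; set a := flatten _.
set ss := [seq Rlist R N | N <- Ns] in a *.
have size_a : size a = sumn (shape ss) by rewrite size_flatten.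
have nth_ss j : (j < size Ns)%N -> nth [::] ss j = Rlist R (nth 0%N Ns j).
  by move=> j_lt; rewrite /ss (nth_map 0%N).
have nth_sh j : (j < size Ns)%N -> nth 0%N (shape ss) j = size (Rlist R (nth 0%N Ns j)).
  by move=> j_lt; rewrite (nth_map [::]) ?nth_ss // (size_map _ Ns).
have idx_lt i : (i < size a)%N -> (reshape_index (shape ss) i < size Ns)%N.
  by rewrite size_a => /reshape_indexP; rewrite !size_map.
pose E (j : 'I_(size Ns)) : {set 'I_(size a)} :=
  [set i : 'I_(size a) | reshape_index (shape ss) i == j].
have nth_a (j : 'I_(size Ns)) i : i \in E j ->
    a`_i = (Rlist R (nth 0%N Ns j))`_(reshape_offset (shape ss) i) /\
    (reshape_offset (shape ss) i < size (Rlist R (nth 0%N Ns j)))%N.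
  rewrite inE => /eqP ij; rewrite nth_flatten ij nth_ss //; split=> //.
  by rewrite -nth_sh // -ij reshape_offsetP // -size_a.
have imE (j : 'I_(size Ns)) :
    [seq a`_(nat_of_ord i) | i <- enum (E j)] =i Rlist R (nth 0%N Ns j).
  move=> x; apply/mapP/idP => [[i]|].
    by rewrite mem_enum => /nth_a[-> off_lt] ->; rewrite mem_nth.
  move=> x_in; have off_lt : (index x (Rlist R (nth 0%N Ns j)) < nth 0%N (shape ss) j)%N.
    by rewrite nth_sh // index_mem.
  have i_lt : (flatten_index (shape ss) j (index x (Rlist R (nth 0%N Ns j))) < size a)%N.
    by rewrite size_a flatten_indexP.
  exists (Ordinal i_lt).
    by rewrite mem_enum inE /= flatten_indexKl.
  by rewrite /= nth_flatten flatten_indexKl // flatten_indexKr // nth_ss // nth_index.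
exists E; split.
- move=> j1 j2 j12; rewrite -setI_eq0; apply/eqP/setP => i; rewrite !inE.
  by apply: contraNF j12 => /andP[/eqP e1 /eqP e2]; apply/eqP/val_inj; rewrite /= -e1.
- apply/setP=> i; rewrite finset.in_setT; apply/bigcupP.
  by exists (Ordinal (idx_lt i (ltn_ord i))); rewrite ?inE.
- move=> j; have N_gt0 : (0 < nth 0%N Ns j)%N by rewrite Ns_gt0 ?mem_nth.
  rewrite -(size_Rlist R) // cardE -(size_map (fun i : 'I_(size a) => a`_i)).
  apply/perm_size/uniq_perm => //; last exact: Rlist_uniq.
  rewrite map_inj_in_uniq ?enum_uniq // => i1 i2; rewrite !mem_enum => i1E i2E.
  have [-> lt1] := nth_a _ _ i1E; have [-> lt2] := nth_a _ _ i2E.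
  move/eqP; rewrite nth_uniq ?Rlist_uniq // => /eqP off12; apply/val_inj => /=.
  rewrite -(reshape_indexK (shape ss) i1) -(reshape_indexK (shape ss) i2) off12.
  by move: i1E i2E; rewrite !inE => /eqP-> /eqP->.
- move=> j; apply/seteqP; split=> x.
    by move=> [i iE ->]; apply/mem_Rlist; have [-> lt] := nth_a _ _ iE; rewrite mem_nth.
  by move/mem_Rlist; rewrite -imE => /mapP[i]; rewrite mem_enum => iE ->; exists i.
Qed.

Lemma Rpartitioned_gt0 (R : realType) (a : seq R) :
  Rpartitioned a -> {in a, forall x, 0 < x}.
Proof.
move=> [Ns /Rpartitioned_perm a_perm] x.
by rewrite (perm_mem a_perm) => /flattenP[_ /mapP[N _ ->]] /Rlist_gt0.
Qed.

Lemma Cseq_gt0 (R : realType) (a : seq R) : Rpartitioned a -> (0 < Cseq a)%N.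
Proof.
move=> [Ns aNs]; rewrite (CseqE aNs) big_seq.
by apply: prodn_cond_gt0 => N /aNs.1/Cnat_gt0.
Qed.

(** * Factorials as products of blocks *)

Lemma pochhammerS (R : realType) (x : R) n :
  pochhammer x n.+1 = pochhammer x n * (x + n%:R).
Proof. exact: big_ord_recr. Qed.

Lemma pochhammer_neq0 (R : realType) (x : R) n : 0 < x -> pochhammer x n != 0.
Proof.
move=> x_gt0; rewrite gt_eqF // prodr_gt0 // => i _.
by rewrite ltr_wpDr.
Qed.

(** The factors are indexed by k < m rather than by an interval depending on
    n: each of them is then the value at n of a fixed polynomial m X + k + 1. *)
Lemma factMnS (m n : nat) :
  ((m * n.+1)`! = (m * n)`! * \prod_(k <- iota 0 m) (m * n + k.+1))%N.
Proof.
have -> : iota 0 m = index_iota 0 m by rewrite /index_iota subn0.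
rewrite mulnS addnC.
elim: {2 4}m => [|k IHk]; first by rewrite addn0 big_geq // muln1.
by rewrite addnS factS IHk big_nat_recr //= mulnC mulnA addnS.
Qed.

Definition Rblock (R : realType) (N n : nat) : R :=
  (Cnat N)%:R ^+ n * \prod_(x <- Rlist R N) pochhammer x n.

Lemma Rblock_neq0 (R : realType) N n : (0 < N)%N -> Rblock R N n != 0.
Proof.
move=> N_gt0; rewrite mulf_neq0 //.
  by rewrite expf_neq0 // pnatr_eq0 -lt0n Cnat_gt0.
by rewrite prodf_seq_neq0; apply/allP => x /Rlist_gt0 x_gt0; exact: pochhammer_neq0.
Qed.

(** From n to n + 1 the left side gains m^m prod_w (w/m + n) =
    prod_w (m n + w) and the right side gains the same factors. *)
Lemma multiplication_formula (R : realType) m n : (0 < m)%N ->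
  (m ^ m)%N%:R ^+ n * \prod_(w <- iota 1 m) pochhammer (w%:R / m%:R : R) n
  = (m * n)`!%:R.
Proof.
move=> m_gt0; have m_neq0 : (m%:R : R) != 0 by rewrite pnatr_eq0 -lt0n.
elim: n => [|n IHn].
  by rewrite muln0 fact0 expr0 mul1r big1 // => w _; rewrite /pochhammer big_ord0.
rewrite factMnS natrM -IHn exprSr -!mulrA; congr (_ * _).
under eq_bigr do rewrite pochhammerS.
rewrite big_split /= mulrCA; congr (_ * _).
rewrite natr_prod -[iota 1 m]/(iota (1 + 0) m) iotaDl big_map.
transitivity (\prod_(k <- iota 0 m) (m%:R : R) *
    \prod_(k <- iota 0 m) ((1 + k)%:R / m%:R + n%:R : R)).
  by congr (_ * _); rewrite big_const_seq count_predT size_iota iter_mulr_1 natrX.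
rewrite -big_split; apply: eq_bigr => k _ /=.
by rewrite mulrDr mulrCA divff // mulr1 -natrM -natrD addnC.
Qed.

Lemma prod_Rblock_divisors (R : realType) m n : (0 < m)%N ->
  \prod_(d <- divisors m) Rblock R d n = (m * n)`!%:R.
Proof.
move=> m_gt0; rewrite big_split /= prodrXl -natr_prod prod_Cnat_divisors //.
rewrite -multiplication_formula //; congr (_ * _).
rewrite -(big_coprimes_divisors _ (fun w => pochhammer (w%:R / m%:R : R) n)) //.
apply: eq_big_seq => d; rewrite -dvdn_divisors // => d_dvd; rewrite big_map.
apply: eq_bigr => v _; congr (pochhammer _ n).
have [q defm] := dvdnP d_dvd.
have [q_gt0 d_gt0] : (0 < q)%N /\ (0 < d)%N.
  by move: m_gt0; rewrite defm muln_gt0 => /andP[].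
rewrite defm mulnK // !natrM; field.
by rewrite !pnatr_eq0 -!lt0n q_gt0 d_gt0.
Qed.

Lemma Rblock1 (R : realType) n : Rblock R 1 n = n`!%:R.
Proof. by rewrite -[in RHS](mul1n n) -prod_Rblock_divisors // big_seq1. Qed.

Lemma prod_Rblock (R : realType) (a : seq R) Ns n : Rpartitioned_by a Ns ->
  (Cseq a)%:R ^+ n * \prod_(x <- a) pochhammer x n = \prod_(N <- Ns) Rblock R N n.
Proof.
move=> aNs; rewrite (CseqE aNs) [RHS]big_split /= prodrXl natr_prod; congr (_ * _).
by rewrite (perm_big _ (Rpartitioned_perm aNs)) big_flatten big_map.
Qed.

Lemma hypergeometric_coefE (R : realType) (a b : seq R) Ns Ms n :
  Rpartitioned_by a Ns -> Rpartitioned_by b Ms ->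
  hypergeometric_coef a b n =
    (\prod_(N <- Ns) Rblock R N n) / (n`!%:R * \prod_(M <- Ms) Rblock R M n).
Proof.
move=> aNs bMs; rewrite -(prod_Rblock _ aNs) -(prod_Rblock _ bMs).
by rewrite /hypergeometric_coef /Cpair expr_div_n !invfM; ring.
Qed.

(** * The equality of P and Q *)

Definition is_factorial_ratio (R : realType) (u : nat -> R) : Prop :=
  exists e f, forall n, u n = factorial_ratio R e f n.

(** Nonemptiness of e and f costs nothing: a zero entry can always be added to
    both, since (0 n)! = 1. *)
Lemma QsetP (R : realType) (u : nat -> R) : Qset R u <-> is_factorial_ratio u.
Proof.
split=> [[e [f [_ _ ->]]]|[e [f ue]]]; first by exists e, f.
exists (0 :: e)%N, (0 :: f)%N; split=> //; apply/funext => n; rewrite ue.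
by rewrite /factorial_ratio !big_cons mul0n fact0 !mul1n.
Qed.

Lemma is_factorial_ratio_fact (R : realType) m :
  is_factorial_ratio (fun n => (m * n)`!%:R : R).
Proof.
by exists [:: m], [::] => n; rewrite /factorial_ratio big_seq1 big_nil divr1.
Qed.

Lemma is_factorial_ratio_div (R : realType) (u v : nat -> R) :
  is_factorial_ratio u -> is_factorial_ratio v ->
  is_factorial_ratio (fun n => u n / v n).
Proof.
move=> [e [f ue]] [e' [f' ve]]; exists (e ++ f'), (f ++ e') => n.
by rewrite ue ve /factorial_ratio !big_cat /= !natrM !invfM invrK; ring.
Qed.

Lemma is_factorial_ratio_mul (R : realType) (u v : nat -> R) :
  is_factorial_ratio u -> is_factorial_ratio v ->
  is_factorial_ratio (fun n => u n * v n).
Proof.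
move=> [e [f ue]] [e' [f' ve]]; exists (e ++ e'), (f ++ f') => n.
by rewrite ue ve /factorial_ratio !big_cat /= !natrM !invfM; ring.
Qed.

Lemma is_factorial_ratio_prod (R : realType) (I : eqType) (s : seq I) (u : I -> nat -> R) :
  {in s, forall i, is_factorial_ratio (u i)} ->
  is_factorial_ratio (fun n => \prod_(i <- s) u i n).
Proof.
elim: s => [|i s IHs] us.
  by exists [::], [::] => n; rewrite /factorial_ratio !big_nil divr1.
have -> : (fun n => \prod_(j <- i :: s) u j n) = (fun n => u i n * \prod_(j <- s) u j n).
  by apply/funext => n; rewrite big_cons.
apply: is_factorial_ratio_mul; first by apply: us; rewrite mem_head.
by apply: IHs => j js; apply: us; rewrite inE js orbT.
Qed.

(** Induction on N: B_N(n) is (N n)! divided by the blocks of the proper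
    divisors of N. *)
Lemma is_factorial_ratio_Rblock (R : realType) N :
  (0 < N)%N -> is_factorial_ratio (Rblock R N).
Proof.
elim/ltn_ind: N => N IHN N_gt0.
have -> : Rblock R N =
    fun n => (N * n)`!%:R / \prod_(d <- rem N (divisors N)) Rblock R d n.
  apply/funext => n; rewrite -prod_Rblock_divisors //.
  rewrite [in RHS](big_rem N) /= ?divisors_id // mulfK //.
  rewrite prodf_seq_neq0; apply/allP => d /mem_rem.
  by rewrite -dvdn_divisors // => /(dvdn_gt0 N_gt0) /Rblock_neq0 ->.
apply: is_factorial_ratio_div; first exact: is_factorial_ratio_fact.
apply: is_factorial_ratio_prod => d.
rewrite mem_rem_uniq ?divisors_uniq // inE -dvdn_divisors // => /andP[d_neq d_dvd].
by apply: IHN; rewrite ?(dvdn_gt0 N_gt0) // ltn_neqAle d_neq dvdn_leq.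
Qed.

Lemma Pset_sub_Qset (R : realType) : (Pset R `<=` Qset R)%classic.
Proof.
move=> _ [a [b [_ _ [Ns aNs] [Ms bMs] ->]]]; apply/QsetP.
have -> : hypergeometric_coef a b = fun n =>
    (\prod_(N <- Ns) Rblock R N n) / ((1 * n)`!%:R * \prod_(M <- Ms) Rblock R M n).
  by apply/funext => n; rewrite mul1n (hypergeometric_coefE _ aNs bMs).
apply: is_factorial_ratio_div; last apply: is_factorial_ratio_mul.
- by apply: is_factorial_ratio_prod => N /aNs.1; apply: is_factorial_ratio_Rblock.
- exact: is_factorial_ratio_fact.
- by apply: is_factorial_ratio_prod => M /bMs.1; apply: is_factorial_ratio_Rblock.
Qed.

(** Zero entries are dropped: they only contribute (0 n)! = 1. *)
Definition all_divisors (e : seq nat) : seq nat :=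
  flatten [seq divisors x | x <- e & (0 < x)%N].

Lemma all_divisors_gt0 e : {in all_divisors e, forall d, 0 < d}%N.
Proof.
move=> d /flattenP[s /mapP[x]]; rewrite mem_filter => /andP[x_gt0 _] ->.
by rewrite -dvdn_divisors // => /(dvdn_gt0 x_gt0).
Qed.

Lemma prod_Rblock_all_divisors (R : realType) e n :
  \prod_(d <- all_divisors e) Rblock R d n = (\prod_(x <- e) (x * n)`!)%N%:R.
Proof.
rewrite big_flatten big_map big_filter natr_prod [RHS](bigID (fun x => 0 < x)%N) /=.
rewrite [X in _ = _ * X]big1 ?mulr1; last by move=> x; rewrite -eqn0Ngt => /eqP->.
by apply: eq_bigr => x; apply: prod_Rblock_divisors.
Qed.

(** Two extra blocks B_1(n) = n! in the numerator compensate the n! which is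
    part of every element of P and the block B_1 put in the denominator; the
    latter makes the second sequence nonempty. *)
Lemma Qset_sub_Pset (R : realType) : (Qset R `<=` Pset R)%classic.
Proof.
move=> _ [e [f [_ _ ->]]].
have e_gt0 : {in [:: 1, 1 & all_divisors e], forall N, 0 < N}%N.
  by move=> N; rewrite !inE => /or3P[/eqP->|/eqP->|/all_divisors_gt0].
have f_gt0 : {in 1 :: all_divisors f, forall N, 0 < N}%N.
  by move=> N; rewrite !inE => /orP[/eqP->|/all_divisors_gt0].
have aNs := Rpartitioned_flatten R e_gt0; have bMs := Rpartitioned_flatten R f_gt0.
exists (flatten [seq Rlist R N | N <- [:: 1, 1 & all_divisors e]]%N).
exists (flatten [seq Rlist R N | N <- 1 :: all_divisors f]%N).
split=> //; [exact: ex_intro aNs | exact: ex_intro bMs |].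
apply/funext => n; rewrite (hypergeometric_coefE _ aNs bMs).
rewrite !big_cons Rblock1 !prod_Rblock_all_divisors /factorial_ratio.
have n_neq0 : (n`!%:R : R) != 0 by rewrite pnatr_eq0 -lt0n fact_gt0.
by rewrite !invfM mulrACA mulfV // mulrACA mulfV // !mul1r.
Qed.

(** * Comparison of constants and degrees *)

(** The pair (c, d) encodes the linear factor c X + d. *)
Definition linear_prod (R : realType) (s : seq (R * R)) : {poly R} :=
  \prod_(z <- s) (z.1 *: 'X + z.2%:P).

Lemma horner_linear_prod (R : realType) s (x : R) :
  (linear_prod s).[x] = \prod_(z <- s) (z.1 * x + z.2).
Proof. by rewrite horner_prod; apply: eq_bigr => z _; rewrite !hornerE. Qed.

Lemma lead_coef_linear_prod (R : realType) (s : seq (R * R)) :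
  {in s, forall z, z.1 != 0} ->
  lead_coef (linear_prod s) = \prod_(z <- s) z.1 /\
  size (linear_prod s) = (size s).+1.
Proof.
move=> s_neq0.
have size_lin : {in s, forall z, size (z.1 *: 'X + z.2%:P) = 2%N}.
  move=> z /s_neq0 z_neq0; rewrite size_polyDl ?size_scale ?size_polyX //.
  by rewrite (leq_ltn_trans (size_polyC_leq1 _)).
split.
  rewrite lead_coef_prod; apply: eq_big_seq => z zs; rewrite /lead_coef size_lin //.
  by rewrite !coefE mulr1 addr0.
rewrite size_prod_seq => [|z zs]; last by rewrite -size_poly_gt0 size_lin.
rewrite (eq_big_seq (fun=> 2%N) size_lin) big_const_seq count_predT iter_addn_0.
by rewrite mul2n -addnn -addnS addKn.
Qed.

(** The difference has infinitely many roots in characteristic 0. *)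
Lemma poly_eq_nat (R : realType) (p q : {poly R}) :
  (forall n : nat, p.[n%:R] = q.[n%:R]) -> p = q.
Proof.
move=> pq; apply/eqP; rewrite -subr_eq0; apply/eqP.
pose s := [seq n%:R : R | n <- iota 0 (size (p - q))].
apply: (@roots_geq_poly_eq0 _ _ s).
- by apply/allP => _ /mapP[n _ ->]; rewrite rootE !hornerE pq subrr.
- by rewrite map_inj_uniq ?iota_uniq // => m n /eqP; rewrite eqr_nat => /eqP.
- by rewrite size_map size_iota.
Qed.

(** Since (x)_(n+1) = (x)_n (n + x), their product at n is the quotient of the
    values at n + 1 and at n of the product of the (x)_n over a. *)
Definition poch_factors (R : realType) (a : seq R) : seq (R * R) :=
  [seq (1, x) | x <- a].

(** The same for the product of the (x n)! over e, by [factMnS]; an entry x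
    gives x factors, all with leading coefficient x. *)
Definition fact_factors (R : realType) (e : seq nat) : seq (R * R) :=
  [seq (x%:R, k.+1%:R) | x <- e, k <- iota 0 x].

Lemma prod_pochhammerS (R : realType) (a : seq R) n :
  \prod_(x <- a) pochhammer x n.+1 =
  \prod_(x <- a) pochhammer x n * (linear_prod (poch_factors a)).[n%:R].
Proof.
rewrite horner_linear_prod big_map -big_split; apply: eq_bigr => x _ /=.
by rewrite pochhammerS mul1r addrC.
Qed.

Lemma prod_factMnS (R : realType) e n :
  (\prod_(x <- e) (x * n.+1)`!)%N%:R =
  (\prod_(x <- e) (x * n)`!)%N%:R * (linear_prod (fact_factors R e)).[n%:R].
Proof.
rewrite horner_linear_prod big_allpairs_dep /= !natr_prod -big_split.
apply: eq_bigr => x _ /=; rewrite factMnS natrM natr_prod; congr (_ * _).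
by apply: eq_bigr => k _; rewrite natrD natrM.
Qed.

Lemma poch_factors_neq0 (R : realType) (a : seq R) :
  {in poch_factors a, forall z, z.1 != 0}.
Proof. by move=> _ /mapP[x _ ->]; exact: oner_neq0. Qed.

Lemma fact_factors_neq0 (R : realType) e : {in fact_factors R e, forall z, z.1 != 0}.
Proof.
move=> _ /allpairsPdep[x [k [_ k_in ->]]]; rewrite pnatr_eq0 -lt0n.
by move: k_in; rewrite mem_iota add0n => /andP[_ /(leq_ltn_trans (leq0n _))].
Qed.

Lemma prod_fact_factors (R : realType) e :
  \prod_(z <- fact_factors R e) z.1 = (\prod_(x <- e) x ^ x)%N%:R :> R.
Proof.
rewrite big_allpairs_dep natr_prod; apply: eq_bigr => x _ /=.
by rewrite big_const_seq count_predT size_iota iter_mulr_1 natrX.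
Qed.

Lemma size_fact_factors (R : realType) e : size (fact_factors R e) = (\sum_(x <- e) x)%N.
Proof.
rewrite size_allpairs_dep sumnE big_map.
by apply: eq_bigr => x _; rewrite size_iota.
Qed.

Lemma prod_poch_factors (R : realType) (a : seq R) :
  \prod_(z <- poch_factors a) z.1 = 1.
Proof. by rewrite big_map big1. Qed.

(** At X = n this is the equality of the two sequences at n + 1 divided by the
    one at n, with denominators cleared. *)
Lemma hypergeometric_factorial_poly (R : realType) (a b : seq R) e f :
  Rpartitioned a -> Rpartitioned b ->
  (forall n, hypergeometric_coef a b n = factorial_ratio R e f n) ->
  Cpair a b *: linear_prod (poch_factors a ++ fact_factors R f)
  = linear_prod ((1, 1) :: poch_factors b ++ fact_factors R e).
Proof.
move=> aR bR hf; apply: poly_eq_nat => n.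
have poch_neq0 (c : seq R) m : Rpartitioned c -> \prod_(x <- c) pochhammer x m != 0.
  move=> /Rpartitioned_gt0 c_gt0; rewrite prodf_seq_neq0; apply/allP => x /c_gt0 x_gt0.
  exact: pochhammer_neq0.
have fact_neq0 (c : seq nat) m : (\prod_(x <- c) (x * m)`!)%N%:R != 0 :> R.
  by rewrite pnatr_eq0 -lt0n prodn_gt0 // => x; rewrite fact_gt0.
have C_neq0 : Cpair a b != 0.
  by rewrite mulf_neq0 ?invr_eq0 // pnatr_eq0 -lt0n Cseq_gt0.
have n_neq0 m : (m`!%:R : R) != 0 by rewrite pnatr_eq0 -lt0n fact_gt0.
rewrite hornerZ /linear_prod big_cons !big_cat !hornerM -!/(linear_prod _).
have -> : (1 *: 'X + 1%:P : {poly R}).[n%:R] = n.+1%:R by rewrite !hornerE -natr1.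
have := hf n.+1; rewrite /hypergeometric_coef /factorial_ratio.
move/eqP; rewrite mulrA eqr_div ?mulf_neq0 ?poch_neq0 ?fact_neq0 //.
have := hf n; rewrite /hypergeometric_coef /factorial_ratio.
move/eqP; rewrite mulrA eqr_div ?mulf_neq0 ?poch_neq0 ?fact_neq0 //.
move=> /eqP h0 /eqP.
rewrite !prod_pochhammerS !prod_factMnS exprS factS natrM.
set A := (linear_prod (poch_factors a)).[_].
set B := (linear_prod (poch_factors b)).[_].
set U := (linear_prod (fact_factors R e)).[_].
set V := (linear_prod (fact_factors R f)).[_].
move=> h1.
(* K is the common value of both sides of the cross-multiplied equality at n,
   the factor to be cancelled from the equality at n + 1. *)
pose K : R := Cpair a b ^+ n * \prod_(x <- a) pochhammer x n * (\prod_(y <- f) (y * n)`!)%N%:R.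
have K_neq0 : K != 0 by rewrite !mulf_neq0 ?expf_neq0 ?poch_neq0 ?fact_neq0.
apply: (mulfI K_neq0).
transitivity (Cpair a b * Cpair a b ^+ n * (\prod_(x <- a) pochhammer x n * A) *
  ((\prod_(y <- f) (y * n)`!)%N%:R * V)); first by rewrite /K; ring.
by rewrite h1 /K h0; ring.
Qed.

Theorem proposition2 (R : realType) :
  Pset R = Qset R /\
  (forall (a b : seq R) (e f : seq nat),
     (0 < size a)%N -> (0 < size b)%N ->
     Rpartitioned a -> Rpartitioned b ->
     (0 < size e)%N -> (0 < size f)%N ->
     (forall n : nat, hypergeometric_coef a b n = factorial_ratio R e f n) ->
     Cpair a b = (\prod_(x <- e) x ^ x)%N%:R / (\prod_(y <- f) y ^ y)%N%:R /\
     (size a)%:Z - (size b)%:Z - 1 =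
       (\sum_(x <- e) x)%N%:Z - (\sum_(y <- f) y)%N%:Z).
Proof.
split; first by apply/seteqP; split; [exact: Pset_sub_Qset | exact: Qset_sub_Pset].
move=> a b e f _ _ aR bR _ _ hf.
have C_neq0 : Cpair a b != 0.
  by rewrite mulf_neq0 ?invr_eq0 // pnatr_eq0 -lt0n Cseq_gt0.
have cat_neq0 (c : seq R) g : {in poch_factors c ++ fact_factors R g, forall z, z.1 != 0}.
  by move=> z; rewrite mem_cat => /orP[/poch_factors_neq0|/fact_factors_neq0].
have [lead_af size_af] := lead_coef_linear_prod (cat_neq0 a f).
have [] := @lead_coef_linear_prod R ((1, 1) :: poch_factors b ++ fact_factors R e).
  by move=> z; rewrite inE => /orP[/eqP->|/cat_neq0//]; exact: oner_neq0.
rewrite -(hypergeometric_factorial_poly aR bR hf) lead_coefZ size_scale // lead_af size_af.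
rewrite big_cons !big_cat /= !prod_poch_factors !prod_fact_factors !mul1r.
rewrite !size_cat !size_map !size_fact_factors => lead_eq [size_eq]; split.
  apply: (canRL (mulfK _)) => //.
  by rewrite pnatr_eq0 -lt0n prodn_gt0 // => x; rewrite expn_gt0; case: x.
lia.
Qed.
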